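(* Let $1\le K\le P$ be integers and let the times taken by each of $P$ workers to compute the gradient on one mini-batch be i.i.d. random variables across workers and mini-batches, with $X_1,\dots,X_P$ denoting i.i.d. copies. Then the expected runtime per iteration of $K$-sync SGD is $$\mathbb{E}[T]=\mathbb{E}[X_{K:P}],$$ where $X_{K:P}$ is the $K$-th order statistic ($K$-th smallest) of $X_1,\dots,X_P$.
   Context: A central parameter server (PS) interacts with $P$ parallel workers; everything other than gradient computation takes zero time. $K$-sync SGD: at each iteration all $P$ workers start computing the gradient on one fresh mini-batch simultaneously; the PS updates the parameter when the first $K$ of the $P$ workers have finished, cancels the remaining $P-K$ workers, and all $P$ workers start afresh for the next iteration. $T$ is the time between two consecutive updates of the parameter at the PS. *)

(* Defs.v *)
From HB Require Import structures.
From mathcomp Require Import all_boot all_order all_algebra finmap.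
From mathcomp Require Import all_classical all_reals all_analysis.

Set Implicit Arguments.
Unset Strict Implicit.
Unset Printing Implicit Defensive.

Import Order.TTheory GRing.Theory Num.Theory.

Local Open Scope classical_set_scope.
Local Open Scope ring_scope.

Definition mutually_independent (d : measure_display) (T : measurableType d)
    (R : realType) (mu : probability T R) (I : choiceType)
    (X : I -> {RV mu >-> R}) : Prop :=
  forall (J : {fset I}) (B : I -> set R), (forall i, measurable (B i)) ->
    mu (\bigcap_(i in [set` J]) (X i @^-1` B i)) =
    (\prod_(i <- J) mu (X i @^-1` B i))%E.

(* Equality of the two [distribution]s as functions would also compare their
   values on non-measurable sets, hence the restriction to Borel sets. *)
Definition same_law (d d' : measure_display) (T : measurableType d)
    (T' : measurableType d') (R : realType) (mu : probability T R)
    (nu : probability T' R) (X : {RV mu >-> R}) (Y : {RV nu >-> R}) : Prop :=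
  forall B : set R, measurable B -> distribution mu X B = distribution nu Y B.

Definition iid (d : measure_display) (T : measurableType d) (R : realType)
    (mu : probability T R) (I : choiceType) (X : I -> {RV mu >-> R}) : Prop :=
  mutually_independent X /\ (forall i j : I, same_law (X i) (X j)).

(* The k-th smallest of x_0, ..., x_(P-1), counted with multiplicity, for
   1 <= k <= P. *)
Definition order_stat (R : realType) (P k : nat) (x : 'I_P -> R) : R :=
  nth 0 (sort <=%R [seq x i | i <- enum 'I_P]) k.-1.

Section KSync.
Variables (R : realType) (P K : nat).

(* [x (n, i)] is the time worker [i] needs for the fresh mini-batch it receives
   at iteration [n]. *)
Variable x : nat * 'I_P -> R.

(* Workers that have finished by time [t] when iteration [n] starts at [s]. *)
Definition finished (n : nat) (s t : R) : {set 'I_P} :=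
  [set i | s + x (n, i) <= t]%SET.

(* [update_time n] is the instant of the n-th parameter update, which is also
   the instant at which all the workers start afresh for iteration [n]; the
   initial parameter is available at time 0. *)
Fixpoint update_time (n : nat) : R :=
  if n is m.+1 then
    let s := update_time m in
    inf [set t | s <= t /\ (K <= #|finished m s t|)%N]
  else 0.

Definition iteration_runtime (n : nat) : R :=
  update_time n.+1 - update_time n.

End KSync.

(* Main.v *)
(** Whatever the past, iteration [n] lasts the [K]-th smallest of the times
    [tau (n, i)], because worker [i] finishes at [s + tau (n, i)] when the
    iteration starts at [s]. The event that an order statistic is less than [r]
    only depends on the set of indices [i] with [x i < r], so by independence
    its probability is determined by the marginal laws. Hence the order
    statistics of [X] and of the [n]-th row of [tau] have the same law, and
    therefore the same expectation, finite or not. *)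
Require Import Defs.
From HB Require Import structures.
From mathcomp Require Import all_boot all_order all_algebra finmap.
From mathcomp Require Import all_classical all_reals all_analysis.
From mathcomp Require Import measurable_realfun.

Import Order.TTheory GRing.Theory Num.Theory.

Local Open Scope classical_set_scope.
Local Open Scope ring_scope.

(** In a sorted sequence the elements satisfying a downward closed predicate form a prefix, whose
    length is the count. *)
Lemma sorted_nth_count (d : Order.disp_t) (T : orderType d) (p : pred T)
    (x0 : T) (s : seq T) (k : nat) :
  {homo p : x y / (y <= x)%O >-> x ==> y} -> sorted <=%O s -> (k < size s)%N ->
  p (nth x0 s k) = (k < count p s)%N.
Proof.
move=> p_down; elim: s k => // a s IHs k /= a_s.
have s_sorted := path_sorted a_s.
have [pa|pNa] := boolP (p a).
  by case: k => [|k] //= ks; rewrite add1n ltnS IHs.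
(* Once the head fails [p], so does every later element, being at least as large. *)
rewrite add0n => ks; have /eqP -> : count p s == 0%N.
  rewrite -leqn0 leqNgt -has_count; apply/hasPn => y ys.
  apply: contra pNa; apply/implyP/p_down.
  by have /allP := order_path_min le_trans a_s; exact.
rewrite ltn0; apply: contraNF pNa; apply/implyP/p_down.
case: k ks => //= k ks.
by have /allP := order_path_min le_trans a_s; apply; rewrite mem_nth.
Qed.

Section order_statistics.
Context (R : realType) (P k : nat).
Hypotheses (k_gt0 : (0 < k)%N) (k_leP : (k <= P)%N).

(** Serves both [<= t], for the runtime, and [< t], for the law. Since [k] is positive, the index
    [k.-1] lies below a count exactly when [k] is at most that count. *)
Lemma order_stat_pred (p : pred R) (x : 'I_P -> R) :
  {homo p : a b / b <= a >-> a ==> b} ->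
  p (order_stat k x) = (k <= #|[set i | p (x i)]%SET|)%N.
Proof.
move=> p_down; rewrite /order_stat (@sorted_nth_count _ R) //.
- rewrite prednK // count_sort -sum1_count -sum1_card big_map big_enum_cond.
  by congr (_ <= _)%N; apply: eq_bigl => i; rewrite !inE.
- by rewrite size_sort size_map size_enum_ord prednK.
Qed.

Lemma order_stat_le (x : 'I_P -> R) (t : R) :
  (order_stat k x <= t) = (k <= #|[set i | (x i <= t)%R]%SET|)%N.
Proof.
by apply: (order_stat_pred (<= t)) => a b ba; apply/implyP; exact: le_trans.
Qed.

Lemma order_stat_lt (x : 'I_P -> R) (t : R) :
  (order_stat k x < t) = (k <= #|[set i | (x i < t)%R]%SET|)%N.
Proof.
by apply: (order_stat_pred (< t)) => a b ba; apply/implyP; exact: le_lt_trans.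
Qed.

Lemma order_stat_ge0 (x : 'I_P -> R) :
  (forall i, 0 <= x i) -> 0 <= order_stat k x.
Proof.
move=> x_ge0; rewrite leNgt order_stat_lt (_ : [set i | _]%SET = finset.set0).
  by rewrite cards0 leqNgt k_gt0.
by apply/setP => i; rewrite !inE ltNge x_ge0.
Qed.

Lemma iteration_runtimeE (x : nat * 'I_P -> R) (n : nat) :
  (forall i, 0 <= x (n, i)) ->
  iteration_runtime k x n = order_stat k (fun i => x (n, i)).
Proof.
move=> x_ge0; rewrite /iteration_runtime /=; set s := update_time k x n.
set y := order_stat _ _.
(* The counting condition at [t] says [y <= t - s], so the infimum is the left endpoint of a closed
   ray. *)
suff -> : [set t | s <= t /\ (k <= #|finished x n s t|)%N] =
    `[s + y, +oo[%classic.
  by rewrite inf_itv // addrAC subrr add0r.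
apply/seteqP; split => t /=; rewrite in_itv /= andbT -lerBrDl order_stat_le.
  move=> [_]; congr (_ <= _)%N; apply: eq_card => i.
  by rewrite !inE lerBrDl.
(* Here [s <= t] follows from [0 <= y <= t - s], by nonnegativity of the times. *)
move=> k_le; split.
  rewrite -subr_ge0; apply: le_trans (order_stat_ge0 _ x_ge0) _.
  by rewrite order_stat_le.
by move: k_le; congr (_ <= _)%N; apply: eq_card => i; rewrite !inE lerBrDl.
Qed.

End order_statistics.

Section laws.
Context (R : realType) (d d' : measure_display).
Context (T : measurableType d) (T' : measurableType d').
Context (mu : probability T R) (nu : probability T' R).

(** The open lower rays are stable under intersection, generate the Borel sets and exhaust the line,
    so uniqueness of measures applies. *)
Lemma same_law_lt (X : {RV mu >-> R}) (Y : {RV nu >-> R}) :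
  (forall r : R, mu [set w | X w < r] = nu [set w | Y w < r]) -> same_law X Y.
Proof.
move=> XY B mB.
have raysI : setI_closed (@RGenInftyO.G R).
  move=> _ _ [a ->] [b ->]; exists (Num.min a b); apply/seteqP; split => z /=;
    rewrite !in_itv /= lt_min; first by move=> [-> ->].
  by move/andP.
apply: (@measure_unique _ R R (@RGenInftyO.G R)
  (fun n => `]-oo, n%:R[%classic)) => //.
- exact: RGenInftyO.measurableE.
- by move=> n; exists n%:R.
- apply/seteqP; split => // z _; exists (Num.bound `|z|) => //=.
  by rewrite in_itv /= (le_lt_trans (ler_norm z)) // archi_boundP.
- move=> _ [r ->].
  have rayE (U : Type) (f : U -> R) : f @^-1` `]-oo, r[ = [set w | f w < r].
    by apply/seteqP; split => w /=; rewrite in_itv.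
  by have := XY r; rewrite -(rayE _ X) -(rayE _ Y).
- by move=> n; rewrite ltey_eq fin_num_measure.
Qed.

Lemma same_law_expectation (X : {RV mu >-> R}) (Y : {RV nu >-> R}) :
  same_law X Y -> ('E_mu[X] = 'E_nu[Y])%E.
Proof.
move=> XY; rewrite unlock.
have int_law (f : R -> \bar R) : measurable_fun setT f ->
    (forall y, 0 <= f y)%E -> (\int[mu]_w f (X w) = \int[nu]_w f (Y w))%E.
  move=> mf f0; rewrite -(ge0_integral_distribution X) //.
  rewrite -(ge0_integral_distribution Y) //.
  by apply: eq_measure_integral => A mA _; exact: XY.
(* Change of variables is applied to the positive and negative parts separately, each a nonnegative
   function of the variable. *)
rewrite integralE [RHS]integralE; congr (_ - _)%E.
  rewrite (funepos_comp EFin X) (funepos_comp EFin Y).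
  by apply: int_law => //; exact: (@measurable_funepos _ R R setT EFin).
rewrite (funeneg_comp EFin X) (funeneg_comp EFin Y).
by apply: int_law => //; exact: (@measurable_funeneg _ R R setT EFin).
Qed.

End laws.

(** Used with [h := pair n] to extract one row of [tau]; injectivity lets the product over the image
    of [A] be reindexed by [A]. *)
Lemma mutually_independent_comp (d : measure_display) (T : measurableType d)
    (R : realType) (mu : probability T R) (I J : choiceType)
    (X : J -> {RV mu >-> R}) (h : I -> J) :
  injective h -> mutually_independent X -> mutually_independent (X \o h).
Proof.
move=> h_inj X_indep A B mB.
(* [B] is transported along [h] and completed by [setT] outside its range. *)
pose B' j := if pselect (exists i, h i = j) is left hj
  then B (projT1 (cid hj)) else setT.
have B'h i : B' (h i) = B i.
  rewrite /B'; case: pselect => [hj|[]]; last by exists i.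
  by case: cid => i' /= /h_inj ->.
have mB' j : measurable (B' j) by rewrite /B'; case: pselect.
have := X_indep (h @` A)%fset B' mB'.
rewrite big_imfset /=; last by move=> i i' _ _; exact: h_inj.
under eq_bigr do rewrite B'h.
move=> <-; congr (mu _); apply/seteqP; split => w /= wB.
  by move=> _ /= /imfsetP[i /= iA ->]; rewrite B'h; exact: wB.
by move=> i iA /=; rewrite -B'h; apply: wB; exact: in_imfset.
Qed.

Lemma mutually_independent_fin (d : measure_display) (T : measurableType d)
    (R : realType) (mu : probability T R) (I : finType)
    (X : I -> {RV mu >-> R}) (B : I -> set R) :
  mutually_independent X -> (forall i, measurable (B i)) ->
  (mu [set w | forall i, B i (X i w)] = \prod_i mu (X i @^-1` B i))%E.
Proof.
move=> X_indep mB; have := X_indep [fset i in I]%fset B mB.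
rewrite big_imfset //= big_enum /= => <-.
congr (mu _); apply/seteqP; split => w wB i /=; first by move=> _; exact: wB.
by apply: wB; rewrite /= inE.
Qed.

Section order_stat_law.
Context (R : realType) (P k : nat).
Hypotheses (k_gt0 : (0 < k)%N) (k_leP : (k <= P)%N).
Local Open Scope ereal_scope.

(** Imposed on all coordinates at once, these constraints say that [S] is exactly the set of indices
    whose value is below [r]. *)
Let ray (r : R) (S : {set 'I_P}) (i : 'I_P) : set R :=
  if i \in S then `]-oo, r[%classic else ~` `]-oo, r[%classic.

Let measurable_ray r S i : measurable (ray r S i).
Proof. by rewrite /ray; case: ifP => _ //; exact: measurableC. Qed.

Let below_eq (U : Type) (x : U -> 'I_P -> R) r (S : {set 'I_P}) :
  (fun w => [set i | (x w i < r)%R]%SET) @^-1` [set S] =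
  [set w | forall i, ray r S i (x w i)].
Proof.
apply/seteqP; split => w /=.
  move=> <- i; rewrite /ray inE.
  by case: ifPn => /=; rewrite in_itv //= => /negP.
move=> wS; apply/setP => i; move: (wS i); rewrite /ray inE.
by case: ifP => _ /=; rewrite in_itv //= => /negP/negbTE.
Qed.

Let order_stat_ltE (U : Type) (x : U -> 'I_P -> R) (r : R) :
  [set w | order_stat k (x w) < r]%R =
  \bigcup_(S in [set S : {set 'I_P} | k <= #|S|]%N)
    [set w | forall i, ray r S i (x w i)].
Proof.
apply/seteqP; split => w /=.
  rewrite order_stat_lt // => kS; exists [set i | (x w i < r)%R]%SET => //.
  by rewrite -below_eq.
by move=> [S kS]; rewrite -below_eq /= => wS; rewrite order_stat_lt // wS.
Qed.

Section one_family.
Context (d : measure_display) (T : measurableType d) (mu : probability T R).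
Variable X : 'I_P -> {RV mu >-> R}.

Let measurable_below r S :
  measurable [set w | forall i, ray r S i (X i w)].
Proof.
have -> : [set w | forall i, ray r S i (X i w)] =
    \bigcap_(i in [set: 'I_P]) (X i @^-1` ray r S i).
  by apply/seteqP; split => w wS i => [_|]; exact: wS.
apply: fin_bigcap_measurable => // i _; rewrite -[X in measurable X]setTI.
exact: (@measurable_funPT _ _ _ _ (X i)).
Qed.

Let measurable_order_stat :
  measurable_fun setT (fun w => order_stat k (fun i => X i w)).
Proof.
apply: (measurability (@RGenInftyO.G R)); first exact: RGenInftyO.measurableE.
move=> _ [_ [r ->] <-]; rewrite setTI.
rewrite (_ : _ @^-1` _ = [set w | order_stat k (fun i => X i w) < r]%R).
  by rewrite order_stat_ltE; exact: fin_bigcup_measurable.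
by apply/seteqP; split => w /=; rewrite in_itv.
Qed.

Definition order_stat_RV : {RV mu >-> R} :=
  HB.pack (fun w => order_stat k (fun i => X i w))
    (isMeasurableFun.Build d _ T R _ measurable_order_stat).

Lemma measure_order_stat_lt (r : R) : mutually_independent X ->
  mu [set w | order_stat_RV w < r]%R =
  \sum_(S \in [set S : {set 'I_P} | k <= #|S|]%N)
    \prod_(i < P) mu (X i @^-1` ray r S i).
Proof.
move=> X_indep; rewrite order_stat_ltE measure_fin_bigcup //.
- by apply: eq_fsbigr => S _; exact: mutually_independent_fin.
- exact: finite_finset.
(* The events are fibres of a single map over distinct sets [S], hence pairwise disjoint. *)
- move=> S S' _ _; rewrite -!(below_eq _ (fun w i => X i w)).
  by move=> -[w [/= <- <-]].
Qed.

End one_family.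

Lemma expectation_order_stat (d d' : measure_display) (T : measurableType d)
    (T' : measurableType d') (mu : probability T R) (nu : probability T' R)
    (X : 'I_P -> {RV mu >-> R}) (Y : 'I_P -> {RV nu >-> R}) :
  mutually_independent X -> mutually_independent Y ->
  (forall i, same_law (X i) (Y i)) ->
  'E_mu[fun w => order_stat k (fun i => X i w)] =
  'E_nu[fun w => order_stat k (fun i => Y i w)].
Proof.
move=> X_indep Y_indep XY.
apply: (@same_law_expectation _ _ _ _ _ mu nu
  (order_stat_RV _ _ mu X) (order_stat_RV _ _ nu Y)).
apply: same_law_lt => r.
(* Both sides are now the same polynomial in marginal probabilities, which agree factor by
   factor. *)
rewrite !measure_order_stat_lt //; apply: eq_fsbigr => S _.
by apply: eq_bigr => i _; exact: XY.
Qed.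

End order_stat_law.

Theorem lemma1 (R : realType) (P K : nat) (K_gt0 : (1 <= K)%N)
  (K_leP : (K <= P)%N)
  (d : measure_display) (Omega : measurableType d) (mu : probability Omega R)
  (tau : nat * 'I_P -> {RV mu >-> R})
  (tau_ge0 : forall ni w, 0 <= tau ni w)
  (tau_iid : iid tau)
  (d' : measure_display) (Omega' : measurableType d') (nu : probability Omega' R)
  (X : 'I_P -> {RV nu >-> R})
  (X_iid : iid X)
  (X_copy : forall i ni, same_law (X i) (tau ni))
  (n : nat) :
  ('E_mu[fun w => iteration_runtime K (fun ni => tau ni w) n] =
   'E_nu[fun w => order_stat K (fun i => X i w)])%E.
Proof.
under eq_fun do rewrite iteration_runtimeE //.
have row_indep : mutually_independent (fun i => tau (n, i)).
  by apply: (@mutually_independent_comp _ _ _ _ _ _ tau (pair n));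
    [move=> i j []|case: tau_iid].
have X_indep : mutually_independent X by case: X_iid.
by apply/esym/expectation_order_stat.
Qed.
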